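(* Let $\mathbb{A}$ be the weighted adjacency matrix of a graph with two strongly connected components, partitioned into blocks so that $$\mathbb{A}^{\top}=\begin{pmatrix} W_{1,1} & 0\\ W_{2,1} & W_{2,2}\end{pmatrix},$$ where the square matrices $W_{1,1}$ and $W_{2,2}$ correspond to the top and the lower component respectively, and the (not necessarily square) matrix $W_{2,1}$ contains the transitions from the top component to the lower component. Let $\lambda_{\max_1}$ and $\lambda_{\max_2}$ be the dominant eigenvalues of $W_{1,1}$ and $W_{2,2}$ respectively, and suppose $\lambda_{\max_1}>\lambda_{\max_2}$. Let $\vec{e}_1$ be the normalised eigenvector of $W_{1,1}$ corresponding to $\lambda_{\max_1}$, and set $\vec{r}_0=W_{2,1}\vec{e}_1$. Then the vector corresponding to the eigenvector centrality of the lower component $W_{2,2}$ (that is, the lower block $\vec{r}$ of the eigenvector $\begin{pmatrix}\vec{e}_1\\ \vec{r}\end{pmatrix}$ of $\mathbb{A}^{\top}$ for the dominant eigenvalue $\lambda_{\max_1}$ of the whole graph, scaled so that its top block is $\vec{e}_1$) is given by $$\vec{r}=\sum_{k=0}^{\infty}\frac{1}{\lambda_{\max_1}}\left(\frac{W_{2,2}}{\lambda_{\max_1}}\right)^{k}\vec{r}_0 .$$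
   Context: A weighted adjacency matrix is a square real matrix with nonnegative entries, indexed by the vertices of a directed graph, whose nonzero entries correspond to the edges. Each diagonal block of the partition is the (transposed) weighted adjacency matrix of a strongly connected component. The dominant eigenvalue of such a nonnegative matrix is its Perron eigenvalue, i.e. the nonnegative real eigenvalue equal to its spectral radius. The eigenvector centrality of a graph with weighted adjacency matrix $\mathbb{A}$ is the nonnegative eigenvector $\vec{x}\neq 0$ satisfying $\mathbb{A}^{\top}\vec{x}=\lambda_{\max}\vec{x}$, where $\lambda_{\max}$ is the dominant eigenvalue of $\mathbb{A}$ (the maximum of the dominant eigenvalues of its components), taken up to positive scaling. The eigenvector centrality of a component is the part of this vector indexed by the vertices of that component. *)

(* Defs.v *)
From HB Require Import structures.
From mathcomp Require Import all_boot all_order all_algebra.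
From mathcomp Require Import all_classical all_reals all_analysis.
From mathcomp Require Import complex.

Set Implicit Arguments.
Unset Strict Implicit.
Unset Printing Implicit Defensive.
Import Order.TTheory GRing.Theory Num.Theory.
Import numFieldNormedType.Exports.

Local Open Scope ring_scope.

Section Graph.
Variables (R : realType) (N : nat).
Implicit Type A : 'M[R]_N.

Definition weighted_adjacency A : Prop := forall i j, 0 <= A i j.

Definition edge A : rel 'I_N := fun i j => A i j != 0.

(* [connect] is reflexive: a vertex lying on no cycle forms a strongly
   connected component on its own, whose diagonal block is the 1 x 1 zero
   matrix. *)
Definition strong_component A (i : 'I_N) : {set 'I_N} :=
  [set j | connect (edge A) i j && connect (edge A) j i]%SET.

Definition strong_components A : {set {set 'I_N}} :=
  [set strong_component A i | i : 'I_N]%SET.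

End Graph.

(* Both blocks are automatically nonempty, since a strong component is. *)
Definition two_strong_components (R : realType) (m n : nat)
    (A : 'M[R]_(m + n)) : Prop :=
  strong_components A =
  [set [set lshift n i | i : 'I_m]; [set rshift m j | j : 'I_n]]%SET.

(* The eigenvalues are the complex ones; the set of their moduli is finite, so
   the supremum is a maximum. [eigenvalue] of MathComp uses row vectors, and a
   square matrix has the same left and right eigenvalues. *)
Definition spectral_radius (R : realType) (N : nat) (W : 'M[R]_N) : R :=
  sup [set Normc.normc z | z in
        [set z : R[i] | eigenvalue (map_mx (real_complex R) W) z]]%classic.

Definition dominant_eigenvalue (R : realType) (N : nat) (W : 'M[R]_N)
    (l : R) : Prop :=
  [/\ 0 <= l, eigenvalue W l & l = spectral_radius W].

Definition nonneg_vector (R : realType) (N : nat) (x : 'cV[R]_N) : Prop :=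
  forall i, 0 <= x i 0.

(* A representative [x] of the eigenvector centrality, which is only defined up
   to positive scaling. *)
Definition eigenvector_centrality (R : realType) (N : nat) (A : 'M[R]_N)
    (x : 'cV[R]_N) : Prop :=
  [/\ nonneg_vector x, x != 0 &
      exists2 l, dominant_eigenvalue A l & A^T *m x = l *: x].

Definition is_norm (R : realType) (V : lmodType R) (nu : V -> R) : Prop :=
  [/\ forall x y, nu (x + y) <= nu x + nu y,
      forall a x, nu (a *: x) = `|a| * nu x &
      forall x, nu x = 0 -> x = 0].

(* Normalisation is with respect to an unspecified norm [nu], which covers the
   1-, 2- and sup-norms alike; the sign is that of the Perron eigenvector. *)
Definition normalised_eigenvector (R : realType) (N : nat)
    (nu : 'cV[R]_N -> R) (W : 'M[R]_N) (l : R) (e : 'cV[R]_N) : Prop :=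
  [/\ nonneg_vector e, nu e = 1 & W *m e = l *: e].

(* Main.v *)
(* The spectrum of a block triangular matrix is the union of the spectra of its
   diagonal blocks, so lambda1 is dominant for A and lambda1 - W22 is
   invertible; the eigenvector equation then has the unique lower block
   q = (lambda1 - W22)^-1 r0. With B = W22 / lambda1, the partial sums telescope
   to q - B^k q. All complex eigenvalues of B have modulus < 1, and B^k q --> 0
   follows from Cayley-Hamilton, peeling off the linear factors of the
   characteristic polynomial one by one. *)
Require Import Defs.
From HB Require Import structures.
From mathcomp Require Import all_boot all_order all_algebra.
From mathcomp Require Import all_classical all_reals all_analysis.
From mathcomp Require Import complex.

Set Implicit Arguments.
Unset Strict Implicit.
Unset Printing Implicit Defensive.
Import Order.TTheory GRing.Theory Num.Theory.
Import numFieldNormedType.Exports.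

Local Open Scope classical_set_scope.
Local Open Scope ring_scope.

Lemma normc_ge0 (R : rcfType) (z : R[i]) : 0 <= Normc.normc z.
Proof. by case: z => a b; exact: sqrtr_ge0. Qed.

Lemma normc_real (R : rcfType) (x : R) : Normc.normc (real_complex R x) = `|x|.
Proof. by rewrite /= expr0n addr0 sqrtr_sqr. Qed.

(** Makes the [sup] in [spectral_radius] meaningful: the eigenvalues are the finitely many roots of
    the characteristic polynomial, so the sum of their moduli is a crude bound. *)
Lemma spectrum_bound (R : realType) (N : nat) (W : 'M[R]_N) :
  exists M, forall z, eigenvalue (map_mx (real_complex R) W) z ->
    Normc.normc z <= M.
Proof.
pose p := char_poly (map_mx (real_complex R) W).
have [rs prs] := closed_field_poly_normal p.
exists (\sum_(z <- rs) Normc.normc z) => z.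
rewrite eigenvalue_root_char -/p prs (monicP (char_poly_monic _)) scale1r.
rewrite root_prod_XsubC => zrs; rewrite (big_rem z)//= lerDl.
by apply: sumr_ge0 => y _; exact: normc_ge0.
Qed.

Lemma eigenvalue_le_spectral_radius (R : realType) (N : nat) (W : 'M[R]_N) z :
  eigenvalue (map_mx (real_complex R) W) z ->
  Normc.normc z <= spectral_radius W.
Proof.
move=> Wz; apply: ub_le_sup; last by exists z.
have [M MW] := spectrum_bound W.
by exists M => _ [y /= Wy <-]; exact: MW.
Qed.

(** Links the real eigenvalue of [dominant_eigenvalue] to the complex ones of [spectral_radius]. *)
Lemma eigenvalue_real_complex (R : rcfType) (N : nat) (W : 'M[R]_N) (l : R) :
  eigenvalue (map_mx (real_complex R) W) (real_complex R l) = eigenvalue W l.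
Proof.
by rewrite !eigenvalue_root_char -map_char_poly fmorph_root.
Qed.

Lemma eigenvalue_tr (F : fieldType) (N : nat) (A : 'M[F]_N) z :
  eigenvalue A^T z = eigenvalue A z.
Proof.
rewrite !eigenvalue_root_char; congr (root _ z).
by rewrite /char_poly -[RHS]det_tr /char_poly_mx linearB/= tr_scalar_mx map_trmx.
Qed.

Lemma eigenvalue_lblock (F : fieldType) (m n : nat) (W11 : 'M[F]_m)
    (W21 : 'M[F]_(n, m)) (W22 : 'M[F]_n) z :
  eigenvalue (block_mx W11 0 W21 W22) z =
  eigenvalue W11 z || eigenvalue W22 z.
Proof.
rewrite !eigenvalue_root_char -rootM; congr (root _ z).
rewrite /char_poly /char_poly_mx map_block_mx raddf0 scalar_mx_block.
by rewrite opp_block_mx add_block_mx subr0 det_lblock.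
Qed.

Lemma dominant_eigenvalue_tr_lblock (R : realType) (m n : nat) (A : 'M[R]_(m + n))
    (W11 : 'M[R]_m) (W21 : 'M[R]_(n, m)) (W22 : 'M[R]_n) (l : R) :
  A^T = block_mx W11 0 W21 W22 -> dominant_eigenvalue W11 l ->
  spectral_radius W22 <= l -> dominant_eigenvalue A l.
Proof.
move=> AE [l0 W11l lE] W22l.
have spE z : eigenvalue (map_mx (real_complex R) A) z =
    eigenvalue (map_mx (real_complex R) W11) z ||
    eigenvalue (map_mx (real_complex R) W22) z.
  by rewrite -eigenvalue_tr map_trmx AE map_block_mx raddf0 eigenvalue_lblock.
have Al : eigenvalue A l.
  by rewrite -eigenvalue_tr AE eigenvalue_lblock W11l.
split=> //; apply/eqP; rewrite eq_le; apply/andP; split.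
  rewrite -[leLHS]ger0_norm// -normc_real.
  by apply: eigenvalue_le_spectral_radius; rewrite eigenvalue_real_complex.
apply: ge_sup.
  exists (Normc.normc (real_complex R l)), (real_complex R l) => //=.
  by rewrite eigenvalue_real_complex.
move=> _ [z /= + <-]; rewrite spE => /orP[|] zW.
  by rewrite lE; exact: eigenvalue_le_spectral_radius.
by apply: le_trans W22l; exact: eigenvalue_le_spectral_radius.
Qed.

(** With [S N] the sum to be bounded, the recurrence gives [S N <= S N.+1 <= |a 0| + |z| * S N + M],
    which is solved for [S N]. *)
Lemma le_sum_normc_recurrence (R : rcfType) (z : R[i]) (a b : nat -> R[i])
    (M : R) :
  Normc.normc z < 1 -> (forall k, a k.+1 = z * a k + b k) ->
  (forall N, \sum_(k < N) Normc.normc (b k) <= M) ->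
  forall N, \sum_(k < N) Normc.normc (a k) <=
    (Normc.normc (a 0%N) + M) / (1 - Normc.normc z).
Proof.
move=> z1 aS bM N; rewrite ler_pdivlMr ?subr_gt0// mulrBr mulr1 lerBlDr.
apply: (@le_trans _ _ (\sum_(k < N.+1) Normc.normc (a k))).
  by rewrite big_ord_recr/= lerDl normc_ge0.
rewrite big_ord_recl -addrA lerD2l.
apply: (@le_trans _ _ (\sum_(k < N) (Normc.normc (b k) +
    Normc.normc (a k) * Normc.normc z))).
  apply: ler_sum => k _; rewrite lift0 aS addrC.
  by apply: le_trans (le_normcD _ _) _; rewrite Normc.normcM mulrC.
by rewrite big_split/= -mulr_suml lerD2r; exact: bM.
Qed.

(* Removing one factor ['X - z%:P] at a time: [a k := (B ^+ k *m v) i 0] satisfies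
   [a k.+1 = z * a k + b k] where [b] is the same sequence for the vector
   [(B - z%:M) *m v], which is killed by the remaining factors. *)
Lemma horner_mx_powers_bounded_sum (R : rcfType) (n : nat) (B : 'M[R[i]]_n.+1)
    (rs : seq R[i]) :
  (forall z, z \in rs -> Normc.normc z < 1) ->
  forall i (v : 'cV_n.+1),
  horner_mx B (\prod_(z <- rs) ('X - z%:P)) *m v = 0 ->
  exists M, forall N, \sum_(k < N) Normc.normc ((B ^+ k *m v) i 0) <= M.
Proof.
elim: rs => [|z rs IH] rs1 i v.
  rewrite big_nil rmorph1 mul1mx => ->; exists 0 => N.
  by rewrite big1// => k _; rewrite mulmx0 mxE Normc.normc0.
(* The factor of [z] is moved to the right so that it acts on [v] first. *)
rewrite big_cons mulrC rmorphM/= rmorphB/= horner_mx_X horner_mx_C.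
rewrite -mulmxA => /(IH _ i)[y yrs|M bM].
  by apply: rs1; rewrite inE yrs orbT.
exists ((Normc.normc ((B ^+ 0 *m v) i 0) + M) / (1 - Normc.normc z)).
apply: (@le_sum_normc_recurrence _ z (fun k => (B ^+ k *m v) i 0)
  (fun k => (B ^+ k *m ((B - z%:M) *m v)) i 0)) => // [|k].
  by apply: rs1; rewrite inE eqxx.
rewrite mulmxBl mulmxBr mul_scalar_mx -scalemxAr mulmxA exprSr.
by move: (_ *m v) (_ *m v) => x y; rewrite !mxE addrCA subrr addr0.
Qed.

Lemma powers_cvg0 (R : realType) (n : nat) (B : 'M[R]_n) (v : 'cV[R]_n) :
  (forall z, eigenvalue (map_mx (real_complex R) B) z -> Normc.normc z < 1) ->
  forall i, (B ^+ k *m v) i 0 @[k --> \oo] --> 0.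
Proof.
case: n B v => [? ? ? []//|n] B v B1 i.
pose C := map_mx (real_complex R) B.
have [rs prs] := closed_field_poly_normal (char_poly C).
rewrite (monicP (char_poly_monic _)) scale1r in prs.
have rs1 z : z \in rs -> Normc.normc z < 1.
  move=> zrs; apply: B1.
  by rewrite eigenvalue_root_char -/C prs root_prod_XsubC.
have /(horner_mx_powers_bounded_sum rs1 i)[M CM] :
    horner_mx C (\prod_(z <- rs) ('X - z%:P)) *m map_mx (real_complex R) v = 0.
  by rewrite -prs Cayley_Hamilton mul0mx.
(* The entries are even absolutely summable, and the terms of a convergent series tend to 0. *)
apply/norm_cvg0P; apply: cvg_series_cvg_0; apply: nondecreasing_is_cvgn.
  by apply/nondecreasing_series.
exists M => _ [N _ <-]; rewrite /series/= big_mkord.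
apply: le_trans (CM N); apply: ler_sum => k _.
by rewrite -rmorphXn/= -map_mxM [X in Normc.normc X]mxE normc_real.
Qed.

(** Balls of matrices are entrywise, and a filter is closed under intersections over the finitely
    many indices. *)
Lemma cvg_mx_entries (R : realType) (m n : nat) (u : ('M[R]_(m, n))^nat)
    (M : 'M[R]_(m, n)) :
  (forall i j, u k i j @[k --> \oo] --> M i j) -> u @ \oo --> M.
Proof.
move=> uM; apply/cvg_ballP => e e0.
have : \forall k \near \oo, forall i j, ball (M i j) e (u k i j).
  apply: filter_forall => i; apply: filter_forall => j.
  by move/cvg_ballP : (uM i j); exact.
by apply: filterS => k Mu; split.
Qed.

Theorem lemma1 (R : realType) (m n : nat) (A : 'M[R]_(m + n))
    (W11 : 'M[R]_m) (W21 : 'M[R]_(n, m)) (W22 : 'M[R]_n)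
    (lambda1 lambda2 : R) (nu : 'cV[R]_m -> R) (e1 : 'cV[R]_m)
    (r0 : 'cV[R]_n)
    (A_adj : weighted_adjacency A)
    (A_comp : two_strong_components A)
    (A_block : A^T = block_mx W11 0 W21 W22)
    (lambda1_dom : dominant_eigenvalue W11 lambda1)
    (lambda2_dom : dominant_eigenvalue W22 lambda2)
    (lambda21 : lambda2 < lambda1)
    (nu_norm : is_norm nu)
    (e1_eig : normalised_eigenvector nu W11 lambda1 e1)
    (r0_def : r0 = W21 *m e1) :
  let partial_sums : ('cV[R]_n)^nat :=
    series (fun k : nat =>
      lambda1^-1 *: ((lambda1^-1 *: W22) ^+ k *m r0)) in
  [/\ dominant_eigenvalue A lambda1,
      cvgn partial_sums &
      forall r : 'cV[R]_n,
        eigenvector_centrality A (col_mx e1 r) <->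
        r = limn partial_sums].
Proof.
move=> s; have [l20 _ l2E] := lambda2_dom.
have l10 : 0 < lambda1 by exact: le_lt_trans lambda21.
have l1N0 : lambda1 != 0 by rewrite gt_eqF.
have A_dom : dominant_eigenvalue A lambda1.
  by apply: dominant_eigenvalue_tr_lblock A_block _ _ => //; rewrite -l2E ltW.
have [e1_ge0 nu_e1 W11e1] := e1_eig.
have l1_spec22 z : eigenvalue (map_mx (real_complex R) W22) z ->
    Normc.normc z < lambda1.
  move=> /eigenvalue_le_spectral_radius zW22; apply: le_lt_trans lambda21.
  by rewrite l2E.
(* A nonzero kernel vector would make [lambda1] an eigenvalue of [W22], against [l1_spec22]. *)
have unitW : lambda1%:M - W22 \in unitmx.
  rewrite unitmxE unitfE; apply/det0P => -[v v0 /eqP].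
  rewrite mulmxBr mul_mx_scalar subr_eq0 eq_sym => /eqP vW.
  have W22l1 : eigenvalue W22 lambda1 by apply/eigenvalueP; exists v.
  rewrite -eigenvalue_real_complex in W22l1; have := l1_spec22 _ W22l1.
  by rewrite normc_real gtr0_norm// ltxx.
have [q solE] : exists q, forall r,
    W21 *m e1 + W22 *m r = lambda1 *: r <-> r = q.
  exists (invmx (lambda1%:M - W22) *m r0) => r; rewrite -r0_def.
  split=> [r0r|->].
    apply: (can_inj (mulKmx unitW)); rewrite mulKVmx//.
    by rewrite mulmxBl mul_scalar_mx -r0r addrK.
  by apply/eqP; rewrite eq_sym -subr_eq -mul_scalar_mx -mulmxBl mulKVmx.
set B := lambda1^-1 *: W22 in s *.
have sE k : s k = q - B ^+ k *m q.
  (* This is the equation of [q] divided by [lambda1]; the [k]-th term of the series is thus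
     [B ^+ k *m q - B ^+ k.+1 *m q]. *)
  have r0q : lambda1^-1 *: r0 = q - B *m q.
    have /solE : q = q by []; rewrite -r0_def => /(canRL (addrK _))->.
    by rewrite scalerBr scalerA mulVf// scale1r scalemxAl.
  elim: k => [|k IH]; first by rewrite /s /series/= big_geq// mul1mx subrr.
  rewrite /s seriesSr -/s IH scalemxAr r0q mulmxBr (mulmxA _ B).
  by rewrite -[B ^+ k *m B]/(B ^+ k * B) -exprSr addrA subrK.
have sq : s @ \oo --> q.
  apply: cvg_mx_entries => i j; rewrite ord1.
  under eq_fun do rewrite sE mxE mxE.
  rewrite -[X in nbhs X]subr0; apply: cvgB; first exact: cvg_cst.
  apply: powers_cvg0 => z zB.
  (* Scaling back, [lambda1 * z] is an eigenvalue of [W22], whence [lambda1 * |z| < lambda1]. *)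
  have /eigenvalueP[v vB v0] := zB.
  have : eigenvalue (map_mx (real_complex R) W22) (real_complex R lambda1 * z).
    apply/eigenvalueP; exists v => //.
    have -> : W22 = lambda1 *: B by rewrite scalerA mulfV// scale1r.
    by rewrite map_mxZ -scalemxAr vB scalerA.
  move=> /l1_spec22; rewrite Normc.normcM normc_real gtr0_norm//.
  by rewrite gtr_pMr.
(* The sign of [q] is read off the series: the blocks of [A] are nonnegative, hence so are all
   terms, the partial sums and their limit. *)
have r0_ge0 : nonneg_vector r0.
  move=> i; rewrite r0_def mxE; apply: sumr_ge0 => j _; apply: mulr_ge0 => //.
  have := A_adj (lshift n j) (rshift m i).
  by rewrite -[A]trmxK A_block mxE block_mxEdl.
have W22_ge0 i j : 0 <= W22 i j.
  have := A_adj (rshift m j) (rshift m i).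
  by rewrite -[A]trmxK A_block mxE block_mxEdr.
have B_ge0 k : nonneg_vector (B ^+ k *m r0).
  elim: k => [|k IH] i; first by rewrite mul1mx.
  rewrite exprS -mulmxA mxE; apply: sumr_ge0 => j _; apply: mulr_ge0 => //.
  by rewrite mxE mulr_ge0// invr_ge0 ltW.
have s_ge0 k i : 0 <= s k i 0.
  rewrite /s /series/= summxE; apply: sumr_ge0 => j _.
  by rewrite mxE; apply: mulr_ge0; [rewrite invr_ge0 ltW | exact: B_ge0].
have limE : limn s = q by exact: cvg_lim.
have q_ge0 : nonneg_vector q.
  move=> i; have /= sqi := cvg_comp _ _ sq (@coord_continuous _ _ _ i 0 q).
  rewrite -(cvg_lim _ sqi)//; apply: limr_ge; first by apply/cvg_ex; exists (q i 0).
  by apply: nearW => k; exact: s_ge0.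
have eigE l r : A^T *m col_mx e1 r = l *: col_mx e1 r <->
    W11 *m e1 = l *: e1 /\ W21 *m e1 + W22 *m r = l *: r.
  rewrite A_block mul_block_col mul0mx addr0 scale_col_mx.
  by split=> [/eq_col_mx//|[-> ->]].
split=> [//||r]; first by apply/cvg_ex; exists q.
rewrite limE; split=> [[_ _ [l A_l]]|->].
  (* Both [l] and [lambda1] equal the spectral radius of [A], so the two eigenvalues coincide. *)
  case: A_l A_dom => _ _ -> [_ _ <-]; rewrite eigE => -[_].
  by move/solE.
split.
- move=> i; rewrite mxE; case: splitP => j _; [exact: e1_ge0 | exact: q_ge0].
(* If the vector vanished, so would [e1]; but homogeneity gives [nu 0 = 0], not 1. *)
- apply: contra_eq_neq nu_e1 => /eqP; rewrite col_mx_eq0 => /andP[/eqP-> _].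
  case: nu_norm => _ nuZ _.
  by rewrite -[0](scale0r (0 : 'cV[R]_m)) nuZ normr0 mul0r eq_sym oner_eq0.
- exists lambda1 => //; apply/eigE; split=> //; exact/solE.
Qed.
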